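(* Let $\mathcal{M}$ be a reversible Markov chain on a state space $\Sigma$ with stationary distribution $\pi$ and label function $\omega:\Sigma\to\mathbb{R}$, let $k\ge 0$ be an integer and let $\varepsilon>0$. Choose $\sigma_0$ from $\pi$ and consider two trajectories $Y_0,\dots,Y_k$ and $Z_0,\dots,Z_k$ of $\mathcal{M}$ from the common starting point $Y_0=Z_0=\sigma_0$, independent of each other given $\sigma_0$. Then $$\Pr\big(\omega(\sigma_0)\text{ is an }\varepsilon\text{-outlier among }\omega(\sigma_0),\omega(Y_1),\dots,\omega(Y_k),\omega(Z_1),\dots,\omega(Z_k)\big)<2\varepsilon.$$
   Context: Markov chains are time-homogeneous, discrete-time, on a discrete (finite or countable) state space $\Sigma$, specified by transition probabilities $P(\sigma,\tau)$. A trajectory of $\mathcal{M}$ is a sequence $X_0,X_1,X_2,\dots$ of random variables with $\Pr(X_i=\sigma_i\mid X_{i-1}=\sigma_{i-1},\dots,X_0=\sigma_0)=P(\sigma_{i-1},\sigma_i)$. A trajectory is $\pi$-stationary if $X_0\sim\pi$, where $\pi$ is a stationary distribution. $\mathcal{M}$ is reversible (with respect to $\pi$) if every $\pi$-stationary trajectory $X_0,\dots,X_k$ has the same distribution as its reverse $X_k,\dots,X_0$. A real number $a_0$ is an $\varepsilon$-outlier among a finite list $a_0,\dots,a_n$ (counted with multiplicity) if $\#\{i\in\{0,\dots,n\}: a_i\le a_0\}\le \varepsilon(n+1)$. *)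

(* Defs.v *)
From HB Require Import structures.
From mathcomp Require Import all_boot all_order all_algebra.
From mathcomp Require Import all_classical all_reals all_analysis.

Set Implicit Arguments.
Unset Strict Implicit.
Unset Printing Implicit Defensive.

Import Order.TTheory GRing.Theory Num.Theory.
Local Open Scope classical_set_scope.
Local Open Scope ring_scope.

Record markov_chain (R : realType) (S : countType) := MarkovChain {
  trans :> S -> S -> R ;
  trans_ge0 : forall s t, 0 <= trans s t ;
  trans_sum1 : forall s, (\esum_(t in [set: S]) (trans s t)%:E = 1)%E }.

Definition stationary (R : realType) (S : countType)
    (M : markov_chain R S) (pi : S -> R) : Prop :=
  [/\ forall s, 0 <= pi s,
      (\esum_(s in [set: S]) (pi s)%:E = 1)%E &
      forall t, (\esum_(s in [set: S]) (pi s * M s t)%:E = (pi t)%:E)%E].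

Section on_a_probability_space.
Context (R : realType) (d : measure_display) (T : measurableType d).
Context (Pr : probability T R) (S : countType).

(* Only meaningful when [Pr B != 0]; every use below has that guard. *)
Definition cond_pr (A B : set T) : R := fine (Pr (A `&` B)) / fine (Pr B).

(* Measurability with respect to the discrete sigma-algebra on [S]. *)
Definition discrete_rv (X : T -> S) : Prop :=
  forall A : set S, measurable (X @^-1` A).

Definition has_law (X : T -> S) (pi : S -> R) : Prop :=
  forall s, Pr (X @^-1` [set s]) = (pi s)%:E.

(* [X 0, ..., X k] is a trajectory of [M]; [X i] is irrelevant for [i > k]. *)
Definition trajectory (M : markov_chain R S) (k : nat) (X : nat -> T -> S) :
    Prop :=
  (forall i, (i <= k)%N -> discrete_rv (X i)) /\
  forall (i : nat) (s : nat -> S), (i < k)%N ->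
    let past := [set w | forall j, (j <= i)%N -> X j w = s j] in
    Pr past != 0%E ->
    cond_pr [set w | X i.+1 w = s i.+1] past = M (s i) (s i.+1).

Definition path_of (k : nat) (X : nat -> T -> S) (w : T) : seq S :=
  [seq X i w | i <- iota 0 k.+1].

Definition cond_indep_paths (k : nat) (sigma0 : T -> S)
    (Y Z : nat -> T -> S) : Prop :=
  forall s : S, Pr (sigma0 @^-1` [set s]) != 0%E ->
  forall A B : set (seq S),
    cond_pr ((path_of k Y @^-1` A) `&` (path_of k Z @^-1` B))
            (sigma0 @^-1` [set s]) =
    cond_pr (path_of k Y @^-1` A) (sigma0 @^-1` [set s]) *
    cond_pr (path_of k Z @^-1` B) (sigma0 @^-1` [set s]).

End on_a_probability_space.

Definition reversible (R : realType) (S : countType)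
    (M : markov_chain R S) (pi : S -> R) : Prop :=
  forall (d : measure_display) (T : measurableType d) (Pr : probability T R)
    (k : nat) (X : nat -> T -> S),
  trajectory Pr M k X -> has_law Pr (X 0%N) pi ->
  forall A : set (seq S),
    Pr (path_of k X @^-1` A) = Pr ((fun w => rev (path_of k X w)) @^-1` A).

(* [a0] is an [eps]-outlier among the list [a0 :: s]. *)
Definition outlier (R : realType) (eps a0 : R) (s : seq R) : bool :=
  (count (fun a => a <= a0) (a0 :: s))%:R <= eps * (size s).+1%:R.

(* Main.v *)
(** Fix [j <= k]. By detailed balance the path [Y j, ..., Y 1, sigma0, Z 1, ...,
    Z (k - j)] has the law of a stationary trajectory [X 0, ..., X k], with
    [sigma0] in the place of [X j]. If [sigma0] is an outlier among the [2k + 1]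
    labels, then at most [m := eps * (2k + 1)] labels of this shorter path are
    at most [omega sigma0]; so the probability sought is at most that of [X j]
    having rank at most [m] among [X 0, ..., X k]. At most [m] indices [j] have
    such a rank, so summing over [j] bounds [k + 1] times the probability by
    [m], and [eps * (2k + 1) / (k + 1) < 2 * eps]. *)

Require Import Defs.
From HB Require Import structures.
From mathcomp Require Import all_boot all_order all_algebra.
From mathcomp Require Import all_classical all_reals all_analysis.
From mathcomp Require Import measurable_realfun.
From mathcomp Require Import ring lra zify.

Set Implicit Arguments.
Unset Strict Implicit.
Unset Printing Implicit Defensive.

Import Order.TTheory GRing.Theory Num.Theory.
Local Open Scope classical_set_scope.
Local Open Scope ring_scope.

(** * Measurability and laws of discrete random variables *)

Section discrete_random_variables.
Context {d : measure_display} {T : measurableType d}.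

Lemma discrete_rv_singleton (S : countType) (V : T -> S) :
  (forall s, measurable (V @^-1` [set s])) -> discrete_rv V.
Proof.
move=> mV A.
have -> : V @^-1` A = \bigcup_(s in A) (V @^-1` [set s]).
  apply/seteqP; split=> [w Aw|w [s As /= ->//]]; by exists (V w).
rewrite bigcup_mkcond; apply: countable_bigcupT_measurable => // s.
by case: ifP.
Qed.

Lemma discrete_rv_pair (S1 S2 : countType) (V1 : T -> S1) (V2 : T -> S2) :
  discrete_rv V1 -> discrete_rv V2 -> discrete_rv (fun w => (V1 w, V2 w)).
Proof.
move=> mV1 mV2; apply: discrete_rv_singleton => -[s1 s2].
have -> : (fun w => (V1 w, V2 w)) @^-1` [set (s1, s2)] =
    V1 @^-1` [set s1] `&` V2 @^-1` [set s2].
  by apply/seteqP; split=> w /= [-> ->].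
exact: measurableI.
Qed.

Lemma discrete_rv_map (I : eqType) (S : countType) (X : I -> T -> S)
    (l : seq I) :
  {in l, forall i, discrete_rv (X i)} ->
  discrete_rv (fun w => [seq X i w | i <- l]).
Proof.
elim: l => [_|i l IHl mX] A.
  rewrite [X in measurable X](_ : _ = [set _ | A [::]]) //.
  by have [|] := pselect (A [::]) => HA;
    [rewrite (_ : [set _ | _] = setT) | rewrite (_ : [set _ | _] = set0)] => //;
    apply/seteqP; split.
have := discrete_rv_pair (mX i (mem_head _ _))
  (IHl (fun j jl => mX j (mem_behead (s := i :: l) jl))).
move=> /(_ [set p | A (p.1 :: p.2)]).
exact.
Qed.

Lemma discrete_rv_path (S : countType) (k : nat) (X : nat -> T -> S) :
  (forall i, (i <= k)%N -> discrete_rv (X i)) -> discrete_rv (path_of k X).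
Proof.
by move=> mX; apply: discrete_rv_map => i; rewrite mem_iota => /andP[_ /mX].
Qed.

(** Countable additivity: [A] is cut into its points, numbered by [pickle], and each piece is the
    preimage of a singleton or empty. *)
Lemma eq_law (R : realType) (Pr : probability T R) (S : countType)
    (V1 V2 : T -> S) :
  discrete_rv V1 -> discrete_rv V2 ->
  (forall s, Pr (V1 @^-1` [set s]) = Pr (V2 @^-1` [set s])) ->
  forall A, Pr (V1 @^-1` A) = Pr (V2 @^-1` A).
Proof.
move=> mV1 mV2 eqV A.
pose F (V : T -> S) n := V @^-1` [set s | A s /\ pickle s = n].
have bigF (V : T -> S) : V @^-1` A = \bigcup_n F V n.
  by apply/seteqP; split=> [w Aw|w [n _ []]//]; exists (pickle (V w)).
have trivF V : trivIset setT (F V).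
  apply/trivIsetP => i j _ _ /eqP ij.
  by apply/seteqP; split=> // w [[_ wi] [_ wj]]; case: ij; rewrite -wi -wj.
have PrF V : discrete_rv V ->
    Pr (V @^-1` A) = (\sum_(0 <= n <oo) Pr (F V n))%E.
  move=> mV; rewrite [in LHS]bigF measure_semi_bigcup//.
    by move=> n; exact: mV.
  by rewrite -bigF; exact: mV.
rewrite !PrF//; apply: eq_eseriesr => n _.
have [[s [As sn]]|nA] := pselect (exists s, A s /\ pickle s = n).
  have FE V : F V n = V @^-1` [set s].
    apply/seteqP; split=> w /=; last by rewrite /F /= => ->.
    by move=> [_]; rewrite -sn => /(pcan_inj pickleK).
  by rewrite !FE eqV.
have FE V : F V n = set0.
  by apply/seteqP; split=> // w Fw; case: nA; exists (V w).
by rewrite !FE !measure0.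
Qed.

End discrete_random_variables.

(** * Path probabilities and their reversal *)

Definition past {T S : Type} (X : nat -> T -> S) (i : nat) (s : nat -> S) :
    set T :=
  [set w | forall j, (j <= i)%N -> X j w = s j].

Lemma size_path_of (d : measure_display) (T : measurableType d)
    (S : countType) (k : nat) (X : nat -> T -> S) w :
  size (path_of k X w) = k.+1.
Proof. by rewrite size_map size_iota. Qed.

Lemma nth_path_of (d : measure_display) (T : measurableType d)
    (S : countType) (k : nat) (X : nat -> T -> S) w x0 i :
  (i <= k)%N -> nth x0 (path_of k X w) i = X i w.
Proof. by move=> ik; rewrite (nth_map 0%N) ?size_iota// nth_iota. Qed.

(** Makes pasts measurable, and lets the independence of whole paths apply to them. The [nth]
    default is never reached, as [i <= k]. *)
Lemma past_path (d : measure_display) (T : measurableType d)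
    (S : countType) (k i : nat) (X : nat -> T -> S)
    (s : nat -> S) : (i <= k)%N ->
  past X i s =
  path_of k X @^-1` [set p | forall j, (j <= i)%N -> nth (s 0%N) p j = s j].
Proof.
move=> ik; apply/seteqP; split=> w /= H j ji; have := H j ji;
  by rewrite nth_path_of// (leq_trans ji).
Qed.

Section trajectories.
Context (R : realType) (S : countType) (M : markov_chain R S) (pi : S -> R).

(** The factor [pi (s 0)] is left out because two paths from a common start share it. *)
Definition weight (s : nat -> S) (i : nat) : R :=
  \prod_(0 <= j < i) M (s j) (s j.+1).

Lemma pr_past (d : measure_display) (T : measurableType d)
    (Pr : probability T R) (k : nat) (X : nat -> T -> S) :
  trajectory Pr M k X -> has_law Pr (X 0%N) pi ->
  forall i s, (i <= k)%N -> Pr (past X i s) = (pi (s 0%N) * weight s i)%:E.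
Proof.
move=> [mX trX] X0 i s; elim: i => [_|i IHi ik].
  rewrite /weight big_geq// mulr1 -X0; congr (Pr _).
  by apply/seteqP; split=> w /= => [/(_ 0%N)|ws [|j]//]; exact.
have mpast j : (j <= k)%N -> measurable (past X j s).
  by move=> jk; rewrite (past_path X s jk); apply: discrete_rv_path.
have pastS : past X i.+1 s = [set w | X i.+1 w = s i.+1] `&` past X i s.
  apply/seteqP; split=> w /=; last first.
    by move=> [Xi H] j; rewrite leq_eqVlt => /predU1P[->//|]; exact: H.
  by move=> H; split=> [|j ji]; apply: H => //; exact: leqW.
have PrE := IHi (ltnW ik).
(* The Markov property is silent about a null past; there both sides are 0, by monotonicity and the
   induction hypothesis. *)
have [P0|P0] := eqVneq (Pr (past X i s)) 0%E.
  have -> : Pr (past X i.+1 s) = 0%E.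
    apply: (@subset_measure0 _ _ _ Pr _ (past X i s)) P0; rewrite ?pastS//.
    - by rewrite -pastS; exact: mpast.
    - by apply: mpast; exact: ltnW.
  move: PrE; rewrite P0 => -[PrE].
  by rewrite /weight big_nat_recr//= mulrA -/(weight s i) -PrE mul0r.
have /(_ P0) := trX i s ik; rewrite /cond_pr -/(past X i s) -pastS => ME.
rewrite -[LHS]fineK ?fin_num_measure//; last exact: mpast.
move: P0 ME; rewrite PrE eqe => P0 ME; congr (_%:E).
rewrite /weight big_nat_recr//= mulrA -/(weight s i).
by move: ME => <-; rewrite mulrCA divff ?mulr1.
Qed.

Lemma pr_past_cond_indep (d : measure_display) (T : measurableType d)
    (Pr : probability T R) (k : nat) (Y Z : nat -> T -> S) :
  trajectory Pr M k Y -> trajectory Pr M k Z -> Y 0%N = Z 0%N ->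
  has_law Pr (Y 0%N) pi -> cond_indep_paths Pr k (Y 0%N) Y Z ->
  forall i j s t, (i <= k)%N -> (j <= k)%N -> s 0%N = t 0%N ->
  Pr (past Y i s `&` past Z j t) = (pi (s 0%N) * weight s i * weight t j)%:E.
Proof.
move=> trY trZ YZ0 Y0 indep i j s t ik jk st0.
have Z0 : has_law Pr (Z 0%N) pi by rewrite -YZ0.
have mY : measurable (past Y i s).
  by rewrite (past_path Y s ik); apply: discrete_rv_path; case: trY.
have mZ : measurable (past Z j t).
  by rewrite (past_path Z t jk); apply: discrete_rv_path; case: trZ.
have PY := pr_past trY Y0 s ik; have PZ := pr_past trZ Z0 t jk.
(* Given a null start, independence says nothing, but the past of [Y] is then already null. *)
have [p0|p0] := eqVneq (pi (s 0%N)) 0.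
  rewrite p0 !mul0r in PY *.
  by apply: subset_measure0 PY => //; exact: measurableI.
have := indep (s 0%N); rewrite Y0 eqe => /(_ p0).
move=> /(_ [set p | forall j, (j <= i)%N -> nth (s 0%N) p j = s j]
  [set p | forall i, (i <= j)%N -> nth (t 0%N) p i = t i]).
rewrite -!past_path// /cond_pr Y0.
(* Each past fixes the starting state, so it is contained in [C]. *)
set C := Y 0%N @^-1` _.
have YC : past Y i s `&` C = past Y i s by apply/setIidl => w; apply.
have ZC : past Z j t `&` C = past Z j t.
  by apply/setIidl => w Zw; rewrite /C /= YZ0 Zw.
rewrite -setIA ZC YC PY PZ -st0 => /(congr1 (fun x => x * pi (s 0%N))).
rewrite /= divfK// => PrE.
rewrite -[LHS]fineK ?PrE ?fin_num_measure//; last exact: measurableI.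
by congr (_%:E); field.
Qed.

(** [reversible] speaks of actual trajectories, so it is applied to the first step of a given one:
    the pair [X 0], [X 1] has a symmetric law. *)
Lemma detailed_balance (d : measure_display) (T : measurableType d)
    (Pr : probability T R) (k : nat) (X : nat -> T -> S) :
  reversible M pi -> (0 < k)%N -> trajectory Pr M k X -> has_law Pr (X 0%N) pi ->
  forall s t, pi s * M s t = pi t * M t s.
Proof.
move=> rev k0 [mX trX] X0.
have tr1 : trajectory Pr M 1 X.
  by split=> [i i1|i s i1]; [apply: mX; lia|apply: trX; lia].
have E s t : Pr (path_of 1 X @^-1` [set [:: s; t]]) = (pi s * M s t)%:E.
  have := pr_past tr1 X0 (nth s [:: s; t]) (leqnn 1).
  rewrite /weight big_nat1 /= => <-; congr (Pr _).
  apply/seteqP; split=> w /=; first by case=> Xs Xt [|[]].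
  by move=> H; rewrite /path_of /= (H 0%N (leq0n _)) (H 1%N (leqnn _)).
move=> s t; have := rev _ _ _ _ _ tr1 X0 [set [:: s; t]].
rewrite E (_ : _ @^-1` _ = path_of 1 X @^-1` [set [:: t; s]]) ?E => [[]//|].
by apply/seteqP; split=> w; rewrite /path_of /= => -[-> ->].
Qed.

(** Detailed balance carries [pi] across one edge at a time. *)
Lemma weight_rev (s : nat -> S) (i : nat) :
  (forall x y, pi x * M x y = pi y * M y x) ->
  pi (s i) * weight (fun j => s (i - j)%N) i = pi (s 0%N) * weight s i.
Proof.
move=> db; elim: i => [|i IHi]; first by rewrite /weight !big_geq.
rewrite /weight big_nat_recl// subn0 subSS subn0 mulrA db.
under eq_bigr do rewrite !subSS.
rewrite -/(weight _ i) mulrAC IHi -mulrA; congr (_ * _).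
by rewrite big_nat_recr.
Qed.

Lemma weight_cat (s : nat -> S) (i k : nat) : (i <= k)%N ->
  weight s k = weight s i * weight (fun j => s (i + j)%N) (k - i).
Proof.
move=> ik; rewrite /weight (big_cat_nat (leq0n i) ik) /=; congr (_ * _).
rewrite -{1}(add0n i) big_addn; apply: eq_bigr => j _.
by rewrite addnC addnS.
Qed.

End trajectories.

(** * Splicing the reverse of [Y] with [Z] *)

(* Indexed by [i], this is [Y j, ..., Y 1, Y 0, Z 1, Z 2, ...]. *)
Definition spliced {T S : Type} (Y Z : nat -> T -> S) (j i : nat) : T -> S :=
  if (i <= j)%N then Y (j - i)%N else Z (i - j)%N.

(** Both events on the right constrain the state at the junction [j]; the constraints agree because
    [Y 0 = Z 0]. *)
Lemma past_spliced {T S : Type} (Y Z : nat -> T -> S) (j k : nat)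
    (s : nat -> S) : (j <= k)%N -> Y 0%N = Z 0%N ->
  past (spliced Y Z j) k s =
  past Y j (fun i => s (j - i)%N) `&` past Z (k - j) (fun i => s (j + i)%N).
Proof.
move=> jk YZ0; apply/seteqP; split=> w /=.
  move=> H; split=> i ij.
    by rewrite /= -H; [rewrite /spliced leq_subr subKn|lia].
  rewrite /= -H /spliced; last lia.
  case: ifP => ji; last by rewrite addKn.
  have -> : i = 0%N by lia.
  by rewrite addn0 subnn YZ0.
move=> [HY HZ] i ik; rewrite /spliced; case: ifPn => ij.
  by rewrite HY ?leq_subr// subKn.
have ji : (j <= i)%N by lia.
by rewrite HZ ?leq_sub2r//= subnKC.
Qed.

Lemma count_iota (P : pred nat) (m n : nat) :
  count P (iota m n) = (\sum_(m <= i < m + n) P i)%N.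
Proof. by rewrite -sum1_count big_mkcond /index_iota addKn. Qed.

(** The spliced path consists of the start, once, and of initial segments of [Y 1, ..., Y k] and
    [Z 1, ..., Z k]. *)
Lemma count_spliced {T S : Type} (Y Z : nat -> T -> S) (P : pred S)
    (j k : nat) (w : T) : (j <= k)%N ->
  (count P [seq spliced Y Z j i w | i <- iota 0 k.+1] <=
   P (Y 0 w) + (count P [seq Y i w | i <- iota 1 k] +
                count P [seq Z i w | i <- iota 1 k]))%N.
Proof.
move=> jk; rewrite !count_map !count_iota !add1n add0n.
(* Cut after index [j] and reverse the first block, so that it runs from [Y 0] up to [Y j]. *)
rewrite (big_cat_nat (n := j.+1))//= big_nat_rev/= add0n.
under eq_big_nat => i ij.
  rewrite /spliced leq_subLR (_ : (j - (j.+1 - i.+1) = i)%N); last lia.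
  rewrite (_ : (j.+1 <= i.+1 + j)%N); last lia.
  over.
under [X in (_ + X)%N]eq_big_nat => i /andP[ij _].
  rewrite /spliced leqNgt ij /=; over.
rewrite big_nat_recl//= -addnA leq_add2l; apply: leq_add.
  rewrite -(big_add1 _ _ 0 j.+1 xpredT (fun i => nat_of_bool (P (Y i w)))) /=.
  by rewrite [leqRHS](big_cat_nat (n := j.+1))//= leq_addr.
rewrite -{1}(add1n j) big_addn.
under eq_bigr do rewrite addnK.
by rewrite [leqRHS](big_cat_nat (n := k.+1 - j))//= ?leq_addr//; lia.
Qed.

(** * Counting indices of low rank *)

(** Take a counted index with the largest entry. All counted entries are at most that one, so their
    number is at most its rank, hence at most [m]. *)
Lemma card_low_rank (R : realType) (n : nat) (q : seq R) (m : R) :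
  size q = n -> 0 <= m ->
  #|[set j : 'I_n | (count (fun a => a <= q`_j) q)%:R <= m]%SET|%:R <= m.
Proof.
move=> sq m0; set B := finset _.
have [->|[j0 j0B]] := set_0Vmem B; first by rewrite cards0.
case: (arg_maxP (fun j : 'I_n => q`_j) j0B) => j jB jmax.
have : j \in B by [].
rewrite /B inE; apply: le_trans; rewrite ler_nat.
have <- : #|[set i : 'I_n | q`_i <= q`_j]%SET| = count (fun a => a <= q`_j) q.
  rewrite -sum1_count (big_nth 0) big_mkord sq sum1_card.
  by apply: eq_card => i; rewrite inE.
by apply: subset_leq_card; apply/fintype.subsetP => i iB; rewrite inE; exact: jmax.
Qed.

(** Integrates the pointwise bound over a space of total mass 1. *)
Lemma sum_measure_le (R : realType) (d : measure_display) (T : measurableType d)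
    (Pr : probability T R) (n : nat) (F : 'I_n -> set T) (m : R) :
  (forall j, measurable (F j)) ->
  (forall w, \sum_(j < n) \1_(F j) w <= m) ->
  (\sum_(j < n) Pr (F j) <= m%:E)%E.
Proof.
move=> mF Fm.
under eq_bigr => j _.
  rewrite -(setIT (F j)) -integral_indic//; over.
rewrite -ge0_integral_sum//=; last first.
- by move=> j; apply/measurable_EFinP; exact: measurable_indic.
apply: (@le_trans _ _ (\int[Pr]_(x in setT) m%:E)%E); last first.
  rewrite integral_cst// [X in (_ * X)%E](_ : _ = 1%E) ?mule1//.
  exact: probability_setT.
apply: ge0_le_integral => //=.
- by move=> w _; apply: sume_ge0.
- by apply: emeasurable_sum => j; apply/measurable_EFinP; exact: measurable_indic.
- by move=> w _; rewrite sumEFin lee_fin.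
Qed.

(** * Averaging over the position of the starting state *)

Theorem theorem2p6 (R : realType) (S : countType) (M : markov_chain R S)
    (pi : S -> R) (omega : S -> R) (k : nat) (eps : R)
    (d : measure_display) (T : measurableType d) (Pr : probability T R)
    (sigma0 : T -> S) (Y Z : nat -> T -> S)
    (pi_stationary : stationary M pi)
    (M_reversible : reversible M pi)
    (eps_gt0 : 0 < eps)
    (sigma0_pi : has_law Pr sigma0 pi)
    (Y_traj : trajectory Pr M k Y)
    (Z_traj : trajectory Pr M k Z)
    (Y_start : Y 0%N = sigma0)
    (Z_start : Z 0%N = sigma0)
    (YZ_indep : cond_indep_paths Pr k sigma0 Y Z) :
  (Pr [set w | outlier eps (omega (sigma0 w))
                 ([seq omega (Y i w) | i <- iota 1 k] ++
                  [seq omega (Z i w) | i <- iota 1 k])]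
   < (2 * eps)%:E)%E.
Proof.
set E := [set w | _].
have YZ0 : Y 0%N = Z 0%N by rewrite Y_start Z_start.
have Y0_pi : has_law Pr (Y 0%N) pi by rewrite Y_start.
have indep : cond_indep_paths Pr k (Y 0%N) Y Z by rewrite Y_start.
have mY i : (i <= k)%N -> discrete_rv (Y i) by case: Y_traj => + _; exact.
have mZ i : (i <= k)%N -> discrete_rv (Z i) by case: Z_traj => + _; exact.
have mspliced j : (j <= k)%N -> discrete_rv (path_of k (spliced Y Z j)).
  move=> jk; apply: discrete_rv_path => i ik; rewrite /spliced.
  by case: ifP => _; [apply: mY; lia|apply: mZ; lia].
have mE : measurable E.
  have mV (X : nat -> T -> S) : (forall i, (i <= k)%N -> discrete_rv (X i)) ->
      discrete_rv (fun w => [seq X i w | i <- iota 1 k]).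
    move=> mX; apply: discrete_rv_map => i.
    by rewrite mem_iota add1n => /andP[_ /mX].
  have := discrete_rv_pair (mY 0%N (leq0n k))
    (discrete_rv_pair (mV Y mY) (mV Z mZ)).
  move=> /(_ [set p | outlier eps (omega p.1)
    (map omega p.2.1 ++ map omega p.2.2)]).
  congr (measurable _); apply/seteqP.
  by split=> w; rewrite /E /= -!map_comp Y_start.
(* For [j = 0] the spliced path is [Z] itself, which serves as the stationary trajectory of
   reference. *)
have law_spliced j A : (j <= k)%N ->
    Pr (path_of k (spliced Y Z j) @^-1` A) =
    Pr (path_of k (spliced Y Z 0) @^-1` A).
  move=> jk; apply: eq_law; [exact: mspliced|exact: mspliced|move=> p].
  have [sp|sp] := eqVneq (size p) k.+1; last first.
    have E0 i : path_of k (spliced Y Z i) @^-1` [set p] = set0.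
      by apply/seteqP; split=> // w /= wp; move: sp; rewrite -wp size_path_of eqxx.
    by rewrite !E0.
  case: p sp => [//|x0 p0]; set p := x0 :: p0 => sp.
  have pastE i : path_of k (spliced Y Z i) @^-1` [set p] =
      past (spliced Y Z i) k (nth x0 p).
    apply/seteqP; split=> w /=; first by move=> <- l lk; rewrite nth_path_of.
    move=> H; apply: (@eq_from_nth _ x0); rewrite size_path_of// => l lk.
    by rewrite nth_path_of// H.
  suff PrE i : (i <= k)%N -> Pr (path_of k (spliced Y Z i) @^-1` [set p]) =
      (pi x0 * weight M (nth x0 p) k)%:E by rewrite !PrE.
  move=> ik; rewrite pastE past_spliced//.
  rewrite (pr_past_cond_indep Y_traj Z_traj YZ0 Y0_pi indep) ?leq_subr//; last first.
    by rewrite subn0 addn0.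
  rewrite subn0.
  rewrite (weight_cat M _ ik) mulrA; congr (_ * _)%:E.
  (* With [k = 0] there is no step to yield detailed balance, but the weights are empty products. *)
  have [k0|k0] := posnP k.
    have -> : i = 0%N by lia.
    by rewrite /weight !big_geq.
  exact: weight_rev (detailed_balance M_reversible k0 Y_traj Y0_pi).
pose m : R := eps * (k + k).+1%:R.
(* Paths whose entry at [j] has rank at most [m]; [m] is the outlier threshold of the full list of
   [2k + 1] labels. *)
pose low (j : nat) : set (seq S) :=
  [set p | (count (fun a => a <= (map omega p)`_j) (map omega p))%:R <= m].
have E_low (j : 'I_k.+1) :
    (Pr E <= Pr (path_of k (spliced Y Z 0) @^-1` low j))%E.
  have jk : (j <= k)%N by rewrite -ltnS.
  rewrite -(law_spliced j)//; apply: le_measure; rewrite ?inE//.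
    exact: mspliced.
  move=> w Ew; pose q := map omega (path_of k (spliced Y Z j) w).
  have qj : q`_j = omega (sigma0 w).
    rewrite (nth_map (sigma0 w)) ?size_path_of// nth_path_of//.
    by rewrite /spliced leqnn subnn Y_start.
  suff : (count (fun a => a <= omega (sigma0 w)) q)%:R <= m by rewrite -qj.
  move: Ew; rewrite /E /outlier /mkset size_cat !size_map !size_iota -/m.
  apply: le_trans; rewrite ler_nat [leqRHS]/= count_cat !count_map.
  have := count_spliced Y Z (fun s => omega s <= omega (sigma0 w)) w jk.
  by rewrite !count_map Y_start.
have : (\sum_(j < k.+1) Pr (path_of k (spliced Y Z 0) @^-1` low j) <= m%:E)%E.
  apply: sum_measure_le => [j|w]; first exact: mspliced.
  have m0 : 0 <= m by rewrite mulr_ge0// ltW.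
  have sq : size (map omega (path_of k (spliced Y Z 0) w)) = k.+1.
    by rewrite size_map size_path_of.
  apply: le_trans (card_low_rank sq m0).
  rewrite -sum1_card natr_sum [leRHS]big_mkcond /=; apply: ler_sum => j _.
  rewrite indicE inE; case: ifPn => // H.
    by case: (_ \in _).
  by rewrite memNset//; apply/negP.
have [p PrE] : exists p, Pr E = p%:E.
  by exists (fine (Pr E)); rewrite fineK// fin_num_measure.
move=> /(le_trans (lee_sum _ (fun j _ => E_low j))).
(* This leaves [(k + 1) p <= eps (2k + 1)]; strictness comes from [2k + 1 < 2 (k + 1)] and
   [eps > 0]. *)
rewrite PrE sumEFin lee_fin lte_fin sumr_const card_ord /m -[p *+ _]mulr_natl.
rewrite -[k.+1%:R]natr1 -[(k + k).+1%:R]natr1 natrD.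
have : 0 <= k%:R :> R by [].
by move: (k%:R : R) => K K0 H; nra.
Qed.
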